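(* Let $\mathcal{M}\subseteq\mathbb{R}^n$ be a discrete $n$-manifold topologically equivalent to $\mathbb{B}^n$, let $\mu$ be the measure defined on $\mathcal{M}$, and let $C$ be a constant. Let $$S_f=\Big\{E_V(f)\ \Big|\ f:\mathcal{M}\to\mathbb{B}^n\text{ is orientation preserving and piecewise affine with }\sum_{\sigma\in\mathbb{S}_n(\mathcal{M})}|f(\sigma)|=C,\ f(\partial\mathcal{M})=\mathbb{S}^{n-1}\Big\},$$ where $E_V(f)=\frac1n\,\mathrm{trace}(\mathbf{f}^\top L_V(f)\,\mathbf{f})$ is the discrete $n$-dimensional volumetric stretch energy. Then: (i) $\min S_f\ge\frac{C^2}{\sum_{\sigma\in\mathbb{S}_n(\mathcal{M})}\mu(\sigma)}$; (ii) a map $f^*$ satisfying the conditions in the definition of $S_f$ is a minimizer with $E_V(f^* )=\min S_f=\frac{C^2}{\sum_{\sigma\in\mathbb{S}_n(\mathcal{M})}\mu(\sigma)}$ if and only if $f^*$ is volume-/mass-preserving, i.e. $$\frac{|f^*(\sigma)|}{\sum_{\tau\in\mathbb{S}_n(\mathcal{M})}|f^*(\tau)|}=\frac{\mu(\sigma)}{\sum_{\tau\in\mathbb{S}_n(\mathcal{M})}\mu(\tau)}\quad\text{for each }\sigma\in\mathbb{S}_n(\mathcal{M}).$$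
   Context: $\mathbb{B}^n$ is the closed unit ball of $\mathbb{R}^n$ and $\mathbb{S}^{n-1}$ the unit sphere. A discrete $n$-manifold $\mathcal{M}$ is a simplicial $n$-complex (a finite union of $n$-simplices, any two of which are disjoint or intersect in a common facet of some dimension) that is topologically equivalent to $\mathbb{B}^n$; $v_1,\dots,v_N$ are its vertices and $\mathbb{S}_k(\mathcal{M})$ is its set of $k$-simplices. $\partial\mathcal{M}$ is its boundary, a simplicial $(n-1)$-complex topologically equivalent to $\mathbb{S}^{n-1}$. The measure is $\mu(\sigma)=\rho(\sigma)|\sigma|$ for $\sigma\in\mathbb{S}_n(\mathcal{M})$, with a positive density $\rho$ that is constant on each $n$-simplex. A piecewise affine map $f$ on $\mathcal{M}$ is affine on every $n$-simplex and determined by its vertex values (barycentric interpolation); it is represented by the matrix $\mathbf{f}\in\mathbb{R}^{N\times n}$ whose $i$-th row is $\mathbf{f}_i=f(v_i)$. It is orientation preserving if it preserves the orientation of the $n$-simplices without folding, so that $f(\mathcal{M})$ is a simplicial $n$-complex. The stretch factor of $\sigma\in\mathbb{S}_n(\mathcal{M})$ is $\sigma_{\mu,f^{-1}}(\sigma)=\frac{\mu(\sigma)}{|f(\sigma)|}$. The volumetric stretch Laplacian matrix $L_V(f)\in\mathbb{R}^{N\times N}$ is $$[L_V(f)]_{ij}=\begin{cases}-w_{ij}(f),&\text{if }[v_i,v_j]\in\mathbb{S}_1(\mathcal{M}),\\ \sum_{\ell\ne i}w_{i\ell}(f),&\text{if } i=j,\\ 0,&\text{otherwise,}\end{cases}\qquad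 w_{ij}(f)=\frac{1}{n(n-1)}\sum_{\sigma\in\mathbb{S}_n(\mathcal{M}):\,[v_i,v_j]\in\mathbb{S}_1(\sigma)}\frac{|f(\sigma_{\hat i\hat j})|}{\sigma_{\mu,f^{-1}}(\sigma)}\cot\theta_{ij}^\sigma(f),$$ where $\sigma_{\hat i\hat j}$ is the $(n-2)$-simplex spanned by the vertices of $\sigma$ other than $v_i,v_j$; $|\cdot|$ denotes volume of the appropriate dimension (a $0$-simplex has volume $1$); and $\theta_{ij}^\sigma(f)$ is the dihedral angle of the simplex $f(\sigma)$ between the facet spanned by its vertices other than $\mathbf{f}_i$ and the facet spanned by its vertices other than $\mathbf{f}_j$.
   Formalization: The condition f(∂M)=S^{n-1}, which no piecewise affine f satisfies for n≥2, is read as: boundary vertices are mapped to S^{n-1} and the radial projection of f(∂M) is S^{n-1}; ''min S_f ≥'' in (i) means that the bound is a lower bound of S_f. *)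

(* Defs.v *)
(* Mathematical Components with MathComp-Analysis; the reals are an arbitrary
   [R : realType].

   Points of R^n are row vectors.  A family of N points is a matrix
   [p : 'M[R]_(N, n)] (one point per row), and a simplex with vertices in this
   family is the finite set [s : {set 'I_N}] of the indices of its vertices. *)
From HB Require Import structures.
From mathcomp Require Import all_boot all_order all_algebra.
From mathcomp Require Import all_classical all_reals all_analysis.

Set Implicit Arguments.
Unset Strict Implicit.
Unset Printing Implicit Defensive.

Import Order.TTheory GRing.Theory Num.Theory.
Import numFieldTopology.Exports.

Local Open Scope classical_set_scope.
Local Open Scope ring_scope.

Section Euclidean.
Context {R : realType} {n : nat}.

Definition dot (x y : 'rV[R]_n) : R := (x *m y^T) 0 0.

(* The library norm on matrices is the max norm, hence this definition. *)
Definition enorm (x : 'rV[R]_n) : R := Num.sqrt (dot x x).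

Definition unit_ball : set 'rV[R]_n := [set x | enorm x <= 1].

Definition unit_sphere : set 'rV[R]_n := [set x | enorm x = 1].

(* The component of [x] orthogonal to the row space of [E]; the rows of [E] are
   meant to be linearly independent, so that E E^T is invertible. *)
Definition orth_comp k (E : 'M[R]_(k, n)) (x : 'rV[R]_n) : 'rV[R]_n :=
  x - x *m E^T *m invmx (E *m E^T) *m E.

(* The angle in [0, pi] between two nonzero vectors. *)
Definition angle (x y : 'rV[R]_n) : R :=
  acos (dot x y / (enorm x * enorm y)).

End Euclidean.

Definition cot {R : realType} (x : R) : R := cos x / sin x.

Definition homeomorphic {T U : topologicalType} (A : set T) (B : set U) : Prop :=
  exists (f : T -> U) (g : U -> T),
    [/\ {within A, continuous f}, {within B, continuous g},
        f @` A `<=` B, g @` B `<=` A &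
        (forall x, A x -> g (f x) = x) /\ (forall y, B y -> f (g y) = y)].

Definition is_minimum {R : realType} (S : set R) (m : R) : Prop :=
  S m /\ lbound S m.

Section Simplex.
Context {R : realType} {n N : nat}.
Implicit Types (p : 'M[R]_(N, n)) (s : {set 'I_N}).

(* The convex hull of the points of [s]; it is empty when [s] is. *)
Definition hull p s : set 'rV[R]_n :=
  [set x | exists t : 'I_N -> R,
     [/\ forall i, 0 <= t i, \sum_(i in s) t i = 1 &
         x = \sum_(i in s) t i *: row i p]].

Definition points p s : seq 'rV[R]_n := [seq row i p | i <- enum s].

(* The k edge vectors issued from the first vertex of a k-simplex [s]. *)
Definition edges k p s : 'M[R]_(k, n) :=
  \matrix_(i < k) ((points p s)`_i.+1 - (points p s)`_0).

(* The k-dimensional volume of the k-simplex [s], where k + 1 = #|s|: 1 / k!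
   times the volume sqrt (det (E E^T)) of the parallelotope spanned by the
   edges from one vertex.  It is 1 for a 0-simplex, and |det E| / n! for an
   n-simplex. *)
Definition volume p s : R :=
  let E := edges #|s|.-1 p s in
  Num.sqrt (\det (E *m E^T)) / (#|s|.-1)`!%:R.

(* The dihedral angle of the simplex [s] between its facets opposite to [i] and
   [j].  These facets meet along the face [r] spanned by the other vertices and
   contain [j] and [i] respectively; the angle is measured between the
   directions orthogonal to [r] pointing from [r] into each of them. *)
Definition dihedral p s (i j : 'I_N) : R :=
  let r := (s :\ i :\ j)%SET in
  let E := edges #|r|.-1 p r in
  let o := (points p r)`_0 in
  angle (orth_comp E (row i p - o)) (orth_comp E (row j p - o)).

End Simplex.

Section Complex.
Context {R : realType} {n N : nat}.
Implicit Types (p : 'M[R]_(N, n)) (K : {set {set 'I_N}}).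

(* [K] is the set of the n-simplices of a simplicial n-complex whose vertices
   are the rows of [p]. With [a] empty, the last clause says that the two
   simplices are disjoint. *)
Definition simplicial_complex p K : Prop :=
  [/\ forall s, s \in K -> #|s| = n.+1 /\ row_free (edges n p s),
      finset.cover K = [set: 'I_N]%SET &
      forall s t, s \in K -> t \in K ->
        exists a : {set 'I_N},
          [/\ a \subset s, a \subset t & hull p s `&` hull p t = hull p a]].

Definition polyhedron p K : set 'rV[R]_n :=
  [set x | exists2 s, s \in K & hull p s x].

(* The facets of the boundary: those of exactly one n-simplex. *)
Definition boundary_facets K : {set {set 'I_N}} :=
  [set t : {set 'I_N} |
     (#|t| == n) && (#|[set s in K | t \subset s]%SET| == 1%N)]%SET.

Definition boundary p K : set 'rV[R]_n := polyhedron p (boundary_facets K).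

Definition discrete_manifold p K : Prop :=
  simplicial_complex p K /\ homeomorphic (polyhedron p K) (@unit_ball R n).

End Complex.

Section Maps.
Context {R : realType} {n N : nat}.
Variables (v : 'M[R]_(N, n)) (K : {set {set 'I_N}}).
Implicit Type f : 'rV[R]_n -> 'rV[R]_n.

Definition piecewise_affine f : Prop :=
  forall s, s \in K ->
    exists (A : 'M[R]_n) (b : 'rV[R]_n),
      forall x, hull v s x -> f x = x *m A + b.

(* The matrix whose i-th row is f(v_i). *)
Definition vertex_mx f : 'M[R]_(N, n) := \matrix_(i < N) f (row i v).

(* Both determinants use the same ordering of the vertices of [s], so the sign
   of their product does not depend on this ordering.  The second clause is the
   absence of folding: f maps the complex onto a simplicial complex. *)
Definition orientation_preserving f : Prop :=
  (forall s, s \in K ->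
     0 < \det (edges n v s) * \det (edges n (vertex_mx f) s)) /\
  simplicial_complex (vertex_mx f) K.

(* The polyhedral form of "f maps the boundary onto the unit sphere".  A
   simplex never lies in the sphere in dimension > 0, so that the equality of
   the two sets is impossible for a piecewise affine f and n > 1.  Instead the
   boundary vertices are mapped to the sphere, and the boundary facets are
   replaced by the spherical simplices with the same vertices, i.e., by their
   radial projections.  The set equality excludes that 0 is in the image of the
   boundary, since 0^-1 = 0. *)
Definition boundary_onto_sphere f : Prop :=
  (forall t i, t \in @boundary_facets n N K -> i \in t ->
     unit_sphere (f (row i v))) /\
  [set (enorm (f x))^-1 *: f x | x in boundary v K] = unit_sphere.

End Maps.

Section Energy.
Context {R : realType} {n N : nat}.
Variables (v : 'M[R]_(N, n)) (K : {set {set 'I_N}}).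
(* The density, constant on each n-simplex. *)
Variable rho : {set 'I_N} -> R.
Implicit Types (f : 'rV[R]_n -> 'rV[R]_n) (s : {set 'I_N}) (i j : 'I_N).

Definition mass s : R := rho s * volume v s.

(* The volume of f(s), for f piecewise affine. *)
Definition image_volume f s : R := volume (vertex_mx v f) s.

Definition stretch_factor f s : R := mass s / image_volume f s.

Definition is_edge i j : bool :=
  (i != j) && [exists s in K, (i \in s) && (j \in s)].

Definition weight f i j : R :=
  (n * n.-1)%:R^-1 *
  \sum_(s in K | [&& i != j, i \in s & j \in s])
     image_volume f (s :\ i :\ j)%SET / stretch_factor f s
       * cot (dihedral (vertex_mx v f) s i j).

Definition laplacian f : 'M[R]_N :=
  \matrix_(i, j)
    if i == j then \sum_(l | l != i) weight f i l
    else if is_edge i j then - weight f i j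
    else 0.

Definition energy f : R :=
  n%:R^-1 * \tr ((vertex_mx v f)^T *m laplacian f *m vertex_mx v f).

(* The maps f over which the energy is minimized. *)
Definition admissible (C : R) f : Prop :=
  [/\ f @` polyhedron v K `<=` unit_ball,
      orientation_preserving v K f,
      piecewise_affine v K f,
      \sum_(s in K) image_volume f s = C &
      boundary_onto_sphere v K f].

Definition energies (C : R) : set R := [set energy f | f in admissible C].

Definition mass_preserving f : Prop :=
  forall s, s \in K ->
    image_volume f s / (\sum_(t in K) image_volume f t) =
    mass s / (\sum_(t in K) mass t).

End Energy.

(* Main.v *)
(* Let g_i be the gradients of the barycentric coordinates of the simplex f(s).
   The cotangent formula |s_ij| cot(theta_ij) = - n (n - 1) |f(s)| g_i . g_j turns
   the Laplacian into the sum over s of |f(s)|^2 / mu(s) times the Gram matrix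
   G G^T of these gradients.  As F^T G = 1 for the matrix F of vertex values, the
   trace of F^T G G^T F is n, so the energy equals the sum of |f(s)|^2 / mu(s).
   The bound and its equality case are then those of the weighted
   Cauchy-Schwarz inequality. *)
Require Import Defs.
From HB Require Import structures.
From mathcomp Require Import all_boot all_order all_algebra ring.
From mathcomp Require Import all_classical all_reals all_analysis.

Set Implicit Arguments.
Unset Strict Implicit.
Unset Printing Implicit Defensive.

Import Order.TTheory GRing.Theory Num.Theory.
Import numFieldTopology.Exports.

Local Open Scope classical_set_scope.
Local Open Scope ring_scope.

(** * Gram matrices and orthogonal projection *)

Lemma mulmx_trE (R : realType) (m n p : nat) (A : 'M[R]_(m, n))
    (B : 'M[R]_(p, n)) i j :
  (A *m B^T) i j = dot (row i A) (row j B).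
Proof. by rewrite /dot !mxE; apply: eq_bigr => k _; rewrite !mxE. Qed.

Lemma dotC (R : realType) (n : nat) (x y : 'rV[R]_n) : dot x y = dot y x.
Proof. by rewrite /dot !mxE; apply: eq_bigr => k _; rewrite !mxE mulrC. Qed.

Lemma dotDl (R : realType) (n : nat) (a b : R) (x y z : 'rV[R]_n) :
  dot (a *: x + b *: y) z = a * dot x z + b * dot y z.
Proof. by rewrite /dot mulmxDl -!scalemxAl !mxE. Qed.

Lemma dot_ge0 (R : realType) (n : nat) (x : 'rV[R]_n) : 0 <= dot x x.
Proof. by rewrite /dot mxE; apply: sumr_ge0 => k _; rewrite !mxE -expr2 sqr_ge0. Qed.

Lemma dot_eq0 (R : realType) (n : nat) (x : 'rV[R]_n) : dot x x = 0 -> x = 0.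
Proof.
rewrite /dot mxE => h; apply/rowP => k; apply/eqP; rewrite mxE -sqrf_eq0 expr2.
have := psumr_eq0P _ h (i := k) isT; rewrite !mxE => -> // {}k _.
by rewrite !mxE -expr2 sqr_ge0.
Qed.

(** If [x] is a row vector killed by [E *m E^T], then the squared length of [x *m E] is 0, so
    [x *m E = 0]. *)
Lemma gram_unitmx (R : realType) (k n : nat) (E : 'M[R]_(k, n)) :
  (E *m E^T \in unitmx) = row_free E.
Proof.
apply/idP/idP => [u | fE].
  by apply/row_freeP; exists (E^T *m invmx (E *m E^T)); rewrite mulmxA mulmxV.
rewrite -row_free_unit -kermx_eq0; apply/eqP/row_matrixP => i; rewrite row0.
set x := row i _.
have xE : x *m (E *m E^T) = 0 by rewrite -row_mul mulmx_ker row0.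
have: x *m E = 0.
  by apply: dot_eq0; rewrite /dot trmx_mul -mulmxA (mulmxA E) mulmxA xE mul0mx mxE.
by rewrite -[X in _ = X](mul0mx _ E) => /(row_free_inj fE).
Qed.

(** For [E] row-free, the orthogonal projection onto the complement of the row space, acting on row
    vectors from the right. *)
Definition orth_mx {R : realType} {k n : nat} (E : 'M[R]_(k, n)) : 'M[R]_n :=
  1%:M - E^T *m invmx (E *m E^T) *m E.

Lemma orth_compE (R : realType) (k n : nat) (E : 'M[R]_(k, n)) x :
  orth_comp E x = x *m orth_mx E.
Proof. by rewrite /orth_mx mulmxBr mulmx1 !mulmxA. Qed.

Lemma orth_mx_tr (R : realType) (k n : nat) (E : 'M[R]_(k, n)) :
  (orth_mx E)^T = orth_mx E.
Proof.
by rewrite /orth_mx linearB /= trmx1 !trmx_mul trmxK trmx_inv trmx_mul trmxK mulmxA.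
Qed.

Lemma orth_mxK (R : realType) (k n : nat) (E : 'M[R]_(k, n)) :
  row_free E -> orth_mx E *m E^T = 0.
Proof.
rewrite -gram_unitmx => u.
by rewrite /orth_mx mulmxBl mul1mx -[X in _ - X]mulmxA mulmxKV ?subrr.
Qed.

Lemma orth_mx_id (R : realType) (k n p : nat) (E : 'M[R]_(k, n))
    (x : 'M[R]_(p, n)) :
  x *m E^T = 0 -> x *m orth_mx E = x.
Proof. by move=> h; rewrite mulmxBr mulmx1 !mulmxA h !mul0mx subr0. Qed.

(* A block transvection replaces [U] by [U']. *)
Lemma det_gram_col_mx (R : realType) (j k n : nat) (U : 'M[R]_(j, n))
    (E : 'M[R]_(k, n)) (U' := U *m orth_mx E) :
  row_free E ->
  \det (col_mx U E *m (col_mx U E)^T) = \det (U' *m U'^T) * \det (E *m E^T).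
Proof.
move=> fE; pose X := U *m E^T *m invmx (E *m E^T).
have -> : col_mx U E = block_mx 1%:M X 0 1%:M *m col_mx U' E.
  rewrite mul_block_col !mul1mx mul0mx add0r /U' /X /orth_mx mulmxBr mulmx1.
  by rewrite !mulmxA subrK.
have UE : U' *m E^T = 0 by rewrite /U' -mulmxA orth_mxK ?mulmx0.
have EU : E *m U'^T = 0 by rewrite -[E]trmxK -trmx_mul UE trmx0.
rewrite trmx_mul mulmxA -(mulmxA (block_mx _ _ _ _)) tr_col_mx mul_col_row UE EU.
by rewrite !det_mulmx det_tr !det_ublock !det1 !mul1r mulr1.
Qed.

Lemma row_free_dsubmx (R : fieldType) (j k n : nat) (U : 'M[R]_(j, n))
    (E : 'M[R]_(k, n)) :
  row_free (col_mx U E) -> row_free E.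
Proof.
case/row_freeP => B; rewrite mul_col_mx scalar_mx_block block_mxEv.
case/eq_col_mx => _ EB; apply/row_freeP; exists (rsubmx B).
by rewrite mulmx_rsub EB row_mxKr.
Qed.

(** Induction on the rows: splitting off the first one leaves the Gram determinant of the others
    times the squared length of its component orthogonal to them, which is nonzero because the whole
    determinant is. *)
Lemma det_gram_gt0 (R : realType) (k n : nat) (E : 'M[R]_(k, n)) :
  row_free E -> 0 < \det (E *m E^T).
Proof.
elim: k E => [|k IH] E; first by rewrite det_mx00 ltr01.
rewrite -[k.+1]/(1 + k)%N in E *; rewrite -(vsubmxK E) => fE.
have fD := row_free_dsubmx fE.
have: \det (E *m E^T) != 0 by rewrite -unitfE -unitmxE gram_unitmx -(vsubmxK E).
rewrite -{1 2}(vsubmxK E) det_gram_col_mx // mulf_eq0 negb_or => /andP[nz _].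
apply: mulr_gt0; last exact: IH.
by rewrite lt_def nz det_mx11 dot_ge0.
Qed.

Lemma det_gram2 (R : realType) (n : nat) (x y : 'rV[R]_n) :
  \det (col_mx x y *m (col_mx x y)^T) = dot x x * dot y y - dot x y ^+ 2.
Proof.
have rowE i : row i (col_mx x y) = if val i == 0%N then x else y.
  apply/rowP => k; rewrite !mxE; case: splitP => j ij; rewrite (ord1 j) in ij *.
    by rewrite -[val i]/(nat_of_ord i) ij.
  by rewrite -[val i]/(nat_of_ord i) ij.
rewrite (expand_det_row _ ord0) !big_ord_recl big_ord0 /cofactor !det_mx11 addr0.
have minor j (A : 'M[R]_(1 + 1)) :
    row' ord0 (col' j A) 0 0 = A (lift ord0 ord0) (lift j ord0) by rewrite !mxE.
rewrite !minor !mulmx_trE !rowE /= (dotC y x).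
ring.
Qed.

(** * Edge matrices and their dependence on the vertex order *)

(** For [t = enum s] this is convertible to [edges k p s]; a list leaves the base vertex and the
    order free. *)
Definition edge_mx {R : realType} {N n : nat} (k : nat) (p : 'M[R]_(N, n))
    (t : seq 'I_N) : 'M[R]_(k, n) :=
  \matrix_(i < k) ([seq row j p | j <- t]`_i.+1 - [seq row j p | j <- t]`_0).

Lemma edge_mx_mul (R : realType) (N n k : nat) (p : 'M[R]_(N, n)) t :
  edge_mx k p t = edge_mx k 1%:M t *m p.
Proof.
apply/row_matrixP => i; rewrite row_mul !rowK mulmxBl.
have h j : [seq row l p | l <- t]`_j = [seq row l 1%:M | l <- t]`_j *m p.
  (* Beyond the end of [t] both entries are the default 0, and 0 times [p] is 0. *)
  have [jt | tj] := ltnP j (size t); last by rewrite !nth_default ?size_map ?mul0mx.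
  case: t jt => // x0 t jt.
  by rewrite !(nth_map x0) // -row_mul mul1mx.
by rewrite !h.
Qed.

Lemma sum_edge_mx (R : realType) (N n k : nat) (p : 'M[R]_(N, n))
    (t : seq 'I_N) x :
  size t = k.+1 -> x \in t ->
  \sum_(l < k) (index x t == l.+1)%:R *: row l (edge_mx k p t) =
    row x p - [seq row j p | j <- t]`_0.
Proof.
move=> st xt.
case e: (index x t) => [|l].
  rewrite big1 => [|l _]; last by rewrite scale0r.
  rewrite (nth_map x) ?st // (_ : nth x t 0 = x) ?subrr //.
  by rewrite -e nth_index.
have lk : (l < k)%N by rewrite -ltnS -e -st index_mem.
rewrite (bigD1 (Ordinal lk)) //= eqxx scale1r big1 ?addr0 => [|j ne]; last first.
  by move: ne; rewrite -val_eqE /= eqSS eq_sym => /negbTE ->; rewrite scale0r.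
by rewrite rowK /= -e (nth_map x) ?index_mem // nth_index.
Qed.

(** An edge of [t] is a difference of two vectors issued from the base vertex of [t'], each of them
    0 or an edge of [t']. The coefficients depend on the lists only, hence [A] is chosen before
    [p]. *)
Lemma edge_mx_int (N k : nat) (t t' : seq 'I_N) :
  size t = k.+1 -> size t' = k.+1 -> {subset t <= t'} ->
  exists A : 'M[int]_k, forall (R : realType) (n : nat) (p : 'M[R]_(N, n)),
    edge_mx k p t = map_mx intr A *m edge_mx k p t'.
Proof.
move=> st st' sub.
have [x0 x0t] : exists x0, x0 \in t.
  by case: (t) st => // x ?; exists x; rewrite mem_head.
exists (\matrix_(i, l) ((index (nth x0 t i.+1) t' == l.+1)%:R -
                        (index (nth x0 t 0) t' == l.+1)%:R)) => R n p.
apply/row_matrixP => i; rewrite row_mul mulmx_sum_row rowK.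
under eq_bigr => l _ do rewrite !mxE rmorphB /= !rmorph_nat scalerBl.
rewrite sumrB !sum_edge_mx //; try by apply/sub/mem_nth; rewrite st ?ltnS.
by rewrite !(nth_map x0) ?st ?st' ?ltnS // opprB addrA subrK.
Qed.

(* The change of basis between the two edge matrices is integral with an integral
   inverse, so its determinant is 1 or -1. *)
Lemma det_gram_edge_mx (R : realType) (N k : nat) (p : 'M[R]_(N, k)) t t' :
  size t = k.+1 -> size t' = k.+1 -> t =i t' -> row_free (edge_mx k p t') ->
  row_free (edge_mx k p t) /\
  \det (edge_mx k p t *m (edge_mx k p t)^T) =
  \det (edge_mx k p t' *m (edge_mx k p t')^T).
Proof.
move=> st st' tt' fV.
have [x|A /(_ R k p) EA] := edge_mx_int st st'; first by rewrite tt'.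
have [x|B /(_ R k p) EB] := edge_mx_int st' st; first by rewrite tt'.
have BA : map_mx intr B *m map_mx intr A = 1%:M :> 'M[R]_k.
  by apply: (row_free_inj fV); rewrite -mulmxA -EA -EB mul1mx.
split.
  by rewrite row_free_unit EA unitmx_mul (mulmx1_unit BA).2 -row_free_unit.
have: \det A ^+ 2 = 1.
  have/(congr1 (fun M => \det M)) := BA.
  rewrite det_mulmx det1 !det_map_mx -rmorphM -[1](rmorph1 (intmul 1)) => /intr_inj.
  move=> /(congr1 absz)/eqP; rewrite abszM muln_eq1 => /andP[_ /eqP dA].
  by rewrite -real_normK ?num_real // -abszE dA.
move=> dA; rewrite EA trmx_mul mulmxA -(mulmxA _ _ (_^T)).
rewrite !det_mulmx !det_tr det_map_mx mulrCA mulrAC -expr2 -rmorphXn /= dA rmorph1.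
by rewrite mul1r.
Qed.

(** * Angles, barycentric gradients and the cotangent formula *)

(** The sine of the angle is [Num.sqrt g] over the product of the norms, and the norms cancel in the
    quotient. Positivity of [g] also makes both vectors nonzero. *)
Lemma cot_angle (R : realType) (n : nat) (a b : 'rV[R]_n)
    (g := dot a a * dot b b - dot a b ^+ 2) :
  0 < g -> cot (angle a b) = dot a b / Num.sqrt g.
Proof.
move=> g0; have a0 := dot_ge0 a; have b0 := dot_ge0 b.
have ab0 : 0 < dot a a * dot b b.
  by rewrite (le_lt_trans (sqr_ge0 (dot a b))) // -subr_gt0.
have sab0 : Num.sqrt (dot a a * dot b b) != 0 by rewrite gt_eqF ?sqrtr_gt0.
have sg0 : Num.sqrt g != 0 by rewrite gt_eqF ?sqrtr_gt0.
rewrite /cot /angle /enorm -sqrtrM //; set c := dot a b / _.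
have c2 : 1 - c ^+ 2 = g / (dot a a * dot b b).
  by rewrite /c expr_div_n sqr_sqrtr ?ltW // /g mulrBl mulfV ?gt_eqF.
have c1 : -1 <= c <= 1.
  rewrite -ler_norml -[_ <= _](expr_le1 (n := 2)) // real_normK ?num_real //.
  by rewrite -subr_ge0 c2 divr_ge0 ?ltW.
rewrite acosK ?in_itv // sin_acos // c2 sqrtrM ?ltW // sqrtrV ?ltW // /c.
by field; rewrite sg0.
Qed.

Lemma dot_orth_comp (R : realType) (k n : nat) (E : 'M[R]_(k, n))
    (z x : 'rV[R]_n) :
  z *m E^T = 0 -> dot z (orth_comp E x) = dot z x.
Proof.
by move=> zE; rewrite orth_compE /dot trmx_mul orth_mx_tr mulmxA orth_mx_id.
Qed.

(* The rows are the gradients of the barycentric coordinates with respect to the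
   vertices in [t], and 0 for the other vertices. *)
Definition gradients {R : realType} {N n : nat} (q : 'M[R]_(N, n))
    (t : seq 'I_N) : 'M[R]_(N, n) :=
  (edge_mx n 1%:M t)^T *m invmx (edge_mx n q t)^T.

Section Gradients.
Variables (R : realType) (N n : nat) (q : 'M[R]_(N, n)) (t : seq 'I_N).
Hypotheses (st : size t = n.+1) (fV : row_free (edge_mx n q t)).

Let V_unit : (edge_mx n q t)^T \in unitmx.
Proof. by rewrite unitmx_tr -row_free_unit. Qed.

(** The derivative of the identity map written in barycentric coordinates. *)
Lemma tr_mul_gradients : q^T *m gradients q t = 1%:M.
Proof. by rewrite mulmxA -trmx_mul -edge_mx_mul mulmxV. Qed.

(** The barycentric coordinates sum to the constant 1. *)
Lemma sum_gradients : const_mx 1 *m gradients q t = 0 :> 'rV_n.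
Proof.
rewrite mulmxA -[const_mx 1]trmxK -trmx_mul trmx_const -edge_mx_mul.
rewrite (_ : edge_mx _ _ _ = 0) ?trmx0 ?mul0mx //.
apply/matrixP => i j; rewrite !mxE.
have x0 : 'I_N by case: (t) st.
by rewrite !(nth_map x0) ?st ?ltnS // !mxE subrr.
Qed.

Lemma gradients_notin i : i \notin t -> row i (gradients q t) = 0.
Proof.
move=> it; rewrite row_mul (_ : row i _ = 0) ?mul0mx //.
apply/rowP => j; rewrite !mxE.
have x0 : 'I_N by case: (t) st.
have ne k : (k < n.+1)%N -> (nth x0 t k == i) = false.
  by move=> kn; apply: contraNF it => /eqP <-; rewrite mem_nth ?st.
by rewrite !(nth_map x0) ?st ?ltnS // !mxE !ne ?ltnS // subrr.
Qed.

(** A barycentric coordinate is affine, so its gradient paired with an edge is the difference of its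
    values at the two ends. *)
Lemma dot_gradients i j k : j \in t -> k \in t ->
  dot (row i (gradients q t)) (row j q - row k q) = (j == i)%:R - (k == i)%:R.
Proof.
move=> jt kt.
(* Coordinates of the vertex [x] in the edge basis, zero for the base vertex. They serve both for
   [q] and for the identity matrix. *)
pose c x : 'rV[R]_n := \row_l (index x t == l.+1)%:R.
have cE x m (p : 'M[R]_(N, m)) : x \in t ->
    row x p = c x *m edge_mx n p t + [seq row j p | j <- t]`_0.
  move=> xt; rewrite mulmx_sum_row.
  by under eq_bigr do rewrite mxE; rewrite sum_edge_mx // subrK.
have d m (p : 'M[R]_(N, m)) : row j p - row k p = (c j - c k) *m edge_mx n p t.
  by rewrite (cE j) // (cE k) // opprD addrACA subrr addr0 mulmxBl.
rewrite /dot d trmx_mul mulmxA -row_mul /gradients mulmxKV // -row_mul.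
by rewrite -trmx_mul -d !mxE.
Qed.
End Gradients.

Lemma volumeE (R : realType) (n N k : nat) (p : 'M[R]_(N, n)) (s : {set 'I_N}) :
  #|s| = k.+1 ->
  volume p s = Num.sqrt (\det (edges k p s *m (edges k p s)^T)) / k`!%:R.
Proof. by rewrite /volume => ->. Qed.

Lemma volume_gt0 (R : realType) (n N k : nat) (p : 'M[R]_(N, n)) (s : {set 'I_N}) :
  #|s| = k.+1 -> row_free (edges k p s) -> 0 < volume p s.
Proof.
move=> cs fE; rewrite (volumeE _ cs) divr_gt0 ?ltr0n ?fact_gt0 //.
by rewrite sqrtr_gt0 det_gram_gt0.
Qed.

(** With a base vertex [o] in the face common to the two facets, the edges to [i] and [j] sit above
    the edges of that face, as [det_gram_col_mx] requires. *)
Lemma edge_mx_cons2 (R : realType) (N n k : nat) (p : 'M[R]_(N, n)) o i j t :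
  edge_mx (1 + 1 + k) p [:: o, i, j & t] =
  col_mx (col_mx (row i p - row o p) (row j p - row o p)) (edge_mx k p (o :: t)).
Proof.
apply/row_matrixP => l; rewrite rowK; case: (split_ordP l) => [u ->|u ->].
  rewrite [RHS]rowKu; case: (split_ordP u) => w -> /=; rewrite (ord1 w).
    by rewrite rowKu row_id.
  by rewrite rowKd row_id.
by rewrite [RHS]rowKd rowK.
Qed.

(** In the plane orthogonal to the common face, the gradients at [i] and [j] form the basis dual to
    [a] and [b], so their product is [- dot a b / g]. The Gram determinant of [s] is [g] times that
    of the face, which relates the two volumes. *)
Lemma volume_cot_dihedral (R : realType) (n N : nat) (q : 'M[R]_(N, n))
    (s : {set 'I_N}) i j (G := gradients q (enum s)) :
  (1 < n)%N -> #|s| = n.+1 -> row_free (edges n q s) ->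
  i \in s -> j \in s -> i != j ->
  volume q (s :\ i :\ j)%SET * cot (dihedral q s i j) =
  - ((n * n.-1)%:R * volume q s * (G *m G^T) i j).
Proof.
rewrite {}/G; case: n q => [|[|m]] //= q _ cs fV si sj ij.
set G := gradients _ _.
have cr : #|(s :\ i :\ j)%SET| = m.+1.
  have := cardsD1 i s; have := cardsD1 j (s :\ i)%SET.
  by rewrite !inE si sj eq_sym ij cs !add1n => -> [<-].
rewrite mulmx_trE (volumeE _ cs) (volumeE _ cr) /dihedral cr /=.
set r := (s :\ i :\ j)%SET in cr *; set E := edges m q r.
case er : (enum r) => [|o r']; first by move: cr; rewrite cardE er.
have -> : (points q r)`_0 = row o q by rewrite /points er.
set x := row i q - _; set y := row j q - _.
set a := orth_comp E x; set b := orth_comp E y.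
have rP k : k \in r -> [/\ k \in enum s, (k == i) = false & (k == j) = false].
  by rewrite !inE mem_enum => /and3P[/negbTE -> /negbTE -> ->].
have orr : o \in r by rewrite -mem_enum er mem_head.
pose W := edge_mx m.+2 q [:: o, i, j & r'].
have WE : W = col_mx (col_mx x y) E by rewrite /W edge_mx_cons2 /E /edges /points -er.
have sz : size (enum s) = m.+3 by rewrite -cardE.
have [fW dW] : row_free W /\ \det (W *m W^T) =
    \det (edges m.+2 q s *m (edges m.+2 q s)^T).
  apply: det_gram_edge_mx => //.
    by move: cr; rewrite cardE er /= => -[->].
  (* Moving [o] past [i] and [j] recovers [enum r]. *)
  move=> k; rewrite mem_enum !in_cons orbCA (orbCA (k == o)) -in_cons -er mem_enum !inE.
  by case: (eqVneq k i) => [->|_] //=; case: (eqVneq k j) => [->|_].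
have fE : row_free E.
  by apply: (@row_free_dsubmx _ _ _ _ (col_mx x y)); move: fW; rewrite WE.
pose g := dot a a * dot b b - dot a b ^+ 2.
have dWE : \det (W *m W^T) = g * \det (E *m E^T).
  rewrite WE; apply: etrans (det_gram_col_mx (col_mx x y) fE) _.
  by rewrite mul_col_mx -!orth_compE det_gram2.
have dE := det_gram_gt0 fE.
have g0 : 0 < g by rewrite -(pmulr_lgt0 _ dE) -dWE det_gram_gt0.
(* The coordinate of a vertex outside [r] vanishes on [r], so its gradient is orthogonal to the
   edges of [r]. *)
have GE k : k \notin r -> row k G *m E^T = 0.
  move=> kr; apply/rowP => l; rewrite [RHS]mxE mulmx_trE row_id /E rowK.
  have rl h : (h < m.+1)%N -> nth o (enum r) h \in r.
    by move=> hm; rewrite -mem_enum mem_nth // -cardE cr.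
  have ne h : h \in r -> (h == k) = false by move=> hr; apply: contraNF kr => /eqP <-.
  rewrite !(nth_map o) -?cardE ?cr ?ltnS // dot_gradients //.
  - by rewrite (ne _ (rl l.+1 (ltn_ord l))) (ne _ (rl 0%N isT)) subrr.
  - by have [] := rP _ (rl l.+1 (ltn_ord l)).
  - by have [] := rP _ (rl 0%N isT).
have [os oi oj] := rP _ orr.
have [ir jr] : i \notin r /\ j \notin r by rewrite !inE !eqxx /= andbF.
have Gx k : dot (row k G) x = (i == k)%:R - (o == k)%:R.
  by rewrite dot_gradients // mem_enum.
have Gy k : dot (row k G) y = (j == k)%:R - (o == k)%:R.
  by rewrite dot_gradients // mem_enum.
have aE : a *m E^T = 0 by rewrite /a orth_compE -mulmxA orth_mxK ?mulmx0.
have bE : b *m E^T = 0 by rewrite /b orth_compE -mulmxA orth_mxK ?mulmx0.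
(* The coefficients are a row of the inverse of the 2 by 2 Gram matrix of [a] and [b]. Since [W] is
   invertible, pairing with its rows suffices. *)
have Gi : row i G = (dot b b / g) *: a + (- (dot a b / g)) *: b.
  have fWT : W^T \in unitmx by rewrite unitmx_tr -row_free_unit.
  set h := RHS; apply: (can_inj (mulmxK fWT)); rewrite WE.
  (* Convertible to the goal, but with the dimension [1 + 1 + m] for [m.+2]. *)
  suff: row i G *m (col_mx (col_mx x y) E)^T = h *m (col_mx (col_mx x y) E)^T by [].
  have hE : h *m E^T = 0 by rewrite mulmxDl -!scalemxAl aE bE !scaler0 addr0.
  rewrite !tr_col_mx !mul_mx_row GE // hE.
  have eq1 (M M' : 'M[R]_1) : M 0 0 = M' 0 0 -> M = M'.
    by move=> e; rewrite [M]mx11_scalar e -mx11_scalar.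
  congr (row_mx (row_mx _ _) _); apply: eq1; rewrite -[LHS]/(dot _ _) -[RHS]/(dot _ _).
    rewrite Gx eqxx oi subr0 dotDl.
    rewrite -(dot_orth_comp x aE) -(dot_orth_comp x bE) -/a.
    by rewrite (dotC b a) /g /= mulr1n; field; rewrite gt_eqF.
  rewrite Gy eq_sym (negbTE ij) oi subr0 dotDl.
  rewrite -(dot_orth_comp y aE) -(dot_orth_comp y bE) -/b.
  by rewrite /g /= mulr0n; field; rewrite gt_eqF.
(* [row j G] pairs to 0 with [a] and to 1 with [b], so only the coefficient of [b] remains. *)
rewrite Gi dotDl (dotC a) (dotC b (row j G)).
rewrite (dot_orth_comp x (GE j jr)) (dot_orth_comp y (GE j jr)) Gx Gy.
rewrite eqxx (negbTE ij) oj /= mulr1n mulr0n !subr0 mulr0 mulr1 add0r mulrN opprK.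
rewrite cot_angle // -/g -dW dWE sqrtrM ?ltW // !factS !natrM.
have -> : dot a b / g = dot a b / Num.sqrt g ^+ 2 by rewrite sqr_sqrtr ?ltW.
have sg0 : Num.sqrt g != 0 by rewrite gt_eqF ?sqrtr_gt0.
have m0 : m`!%:R != 0 :> R by rewrite pnatr_eq0 -lt0n fact_gt0.
by field; rewrite sg0 m0 -(natrD _ 1 m) -(natrD _ 2 m) !pnatr_eq0.
Qed.

(** * The Laplacian and the energy in terms of gradients *)

Section Energy.
Variables (R : realType) (n N : nat) (v : 'M[R]_(N, n)) (K : {set {set 'I_N}}).
Variables (rho : {set 'I_N} -> R) (f : 'rV[R]_n -> 'rV[R]_n).
Hypotheses (n_gt1 : (1 < n)%N)
  (Kf : forall s, s \in K -> #|s| = n.+1 /\ row_free (edges n (vertex_mx v f) s)).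

Let c s := image_volume v f s ^+ 2 / mass v rho s.
Let G (s : {set 'I_N}) := gradients (vertex_mx v f) (enum s).

(** One factor of the squared image volume comes from the cotangent formula, the other from the
    stretch factor. Simplices missing [i] or [j] contribute 0 because the gradient there is 0. *)
Lemma weightE i j : i != j ->
  weight v K rho f i j = - \sum_(s in K) c s * (G s *m (G s)^T) i j.
Proof.
move=> ij; rewrite /weight mulr_sumr -sumrN big_mkcondr /=.
apply: eq_bigr => s /Kf [cs fV].
have [si|nsi] := boolP (i \in s); last first.
  rewrite !andbF mulmx_trE gradients_notin -?cardE ?mem_enum //.
  by rewrite /dot mul0mx mxE mulr0 oppr0.
have [sj|nsj] := boolP (j \in s); last first.
  rewrite !andbF mulmx_trE dotC gradients_notin -?cardE ?mem_enum //.
  by rewrite /dot mul0mx mxE mulr0 oppr0.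
rewrite ij /= /G /c.
have vc := volume_cot_dihedral n_gt1 cs fV si sj ij.
rewrite (mulrAC (image_volume _ _ _)) [X in X * cot _]/image_volume vc.
rewrite /stretch_factor invf_div -/(image_volume v f s).
have nn : (n * n.-1)%:R != 0 :> R.
  by rewrite pnatr_eq0 muln_eq0 negb_or -!lt0n ltn_predRL n_gt1 andbT ltnW.
move: (n * n.-1)%N nn => k nn.
rewrite !mulNr mulrN -mulrA !(mulrA k%:R^-1) mulVf // mul1r expr2.
by rewrite mulrAC !mulrA.
Qed.

(** Off the diagonal this is [weightE]. On the diagonal it suffices that the rows of the right-hand
    side sum to 0, as the gradients of each simplex do. *)
Lemma laplacianE : laplacian v K rho f = \sum_(s in K) c s *: (G s *m (G s)^T).
Proof.
set A := RHS.
have AE i j : A i j = \sum_(s in K) c s * (G s *m (G s)^T) i j.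
  by rewrite /A summxE; under eq_bigr do rewrite mxE.
have A1 : A *m const_mx 1 = 0 :> 'cV_N.
  rewrite mulmx_suml big1 // => s /Kf[cs fV]; rewrite -scalemxAl -mulmxA.
  rewrite -[const_mx 1]trmxK -trmx_mul trmx_const sum_gradients -?cardE //.
  by rewrite trmx0 mulmx0 scaler0.
have A_diag i : \sum_(l | l != i) A i l = - A i i.
  have := congr1 (fun M : 'cV_N => M i 0) A1; rewrite !mxE (bigD1 i) //=.
  under eq_bigr do rewrite mxE mulr1.
  by rewrite mxE mulr1 addrC => /eqP; rewrite addr_eq0 => /eqP.
apply/matrixP => i j; rewrite mxE; case: eqVneq => [<-|ij].
  rewrite -[RHS]opprK -A_diag -sumrN; apply: eq_bigr => l li.
  by rewrite weightE 1?eq_sym // AE.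
(* For a non-edge the sum defining the weight is empty. *)
rewrite AE -[RHS]opprK -weightE //; case: ifPn => // /negP ne.
rewrite /weight big_pred0 ?mulr0 ?oppr0 // => s; apply/negP => /and4P[sK _ si sj].
by apply: ne; rewrite /is_edge ij; apply/existsP; exists s; rewrite sK si.
Qed.

Lemma energyE :
  energy v K rho f = \sum_(s in K) image_volume v f s ^+ 2 / mass v rho s.
Proof.
rewrite /energy laplacianE mulmx_sumr mulmx_suml linear_sum mulr_sumr /=.
apply: eq_bigr => s /Kf[cs fV].
rewrite -scalemxAr -scalemxAl linearZ /= mulmxA -(mulmxA (_ *m _)).
have -> : (G s)^T *m vertex_mx v f = ((vertex_mx v f)^T *m G s)^T.
  by rewrite [RHS]trmx_mul trmxK.
rewrite tr_mul_gradients -?cardE // trmx1 mulmx1 mxtrace1.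
by rewrite mulrCA mulVf ?mulr1 // pnatr_eq0 -lt0n (ltn_trans _ n_gt1).
Qed.
End Energy.

(** * The lower bound and its equality case *)

(* Since [\sum_s a s ^ 2 / m s - (\sum_s a s) ^ 2 / \sum_s m s] is the variance
   of [a s / m s] for the weights [m s]. *)
Lemma sum_sqr_div (R : realType) (I : finType) (K : {set I}) (a m : I -> R) :
  (forall s, s \in K -> 0 < m s) ->
  let A := \sum_(s in K) a s in let M := \sum_(s in K) m s in
  \sum_(s in K) a s ^+ 2 / m s - A ^+ 2 / M =
  \sum_(s in K) m s * (a s / m s - A / M) ^+ 2.
Proof.
move=> m0 A M.
have [K0|[s0 Ks0]] := set_0Vmem K.
  (* With [K] empty, [M^-1] is 0 by convention and both sides vanish. *)
  by rewrite /A /M K0 !big_set0 invr0 mulr0 subrr.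
have M0 : 0 < M.
  rewrite /M (bigD1 s0) //= ltr_pwDl ?m0 // sumr_ge0 // => s /andP[Ks _].
  by rewrite ltW ?m0.
have -> : \sum_(s in K) m s * (a s / m s - A / M) ^+ 2 =
    \sum_(s in K) (a s ^+ 2 / m s - 2 * (A / M) * a s + (A / M) ^+ 2 * m s).
  by apply: eq_bigr => s Ks; field; rewrite !gt_eqF ?m0.
rewrite !big_split /= sumrN -!mulr_sumr -/A -/M.
by field; rewrite gt_eqF.
Qed.

Theorem theorem4 (R : realType) (n N : nat) (hn : (1 < n)%N)
    (v : 'M[R]_(N, n)) (K : {set {set 'I_N}}) (hM : discrete_manifold v K)
    (rho : {set 'I_N} -> R) (hrho : forall s, s \in K -> 0 < rho s) (C : R) :
  lbound (energies v K rho C) (C ^+ 2 / \sum_(s in K) mass v rho s) /\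
  (forall f : 'rV[R]_n -> 'rV[R]_n, admissible v K C f ->
     (is_minimum (energies v K rho C) (energy v K rho f) /\
      energy v K rho f = C ^+ 2 / \sum_(s in K) mass v rho s)
     <-> mass_preserving v K rho f).
Proof.
have mass_gt0 s : s \in K -> 0 < mass v rho s.
  move=> Ks; case: hM => [[hK _ _] _]; have [cs fE] := hK s Ks.
  by rewrite mulr_gt0 ?hrho ?(volume_gt0 cs fE).
(* The excess over the bound is a sum of nonnegative terms, so it vanishes exactly when each term
   does. *)
have energyB f : admissible v K C f ->
    energy v K rho f - C ^+ 2 / \sum_(s in K) mass v rho s =
    \sum_(s in K) mass v rho s *
      (image_volume v f s / mass v rho s - C / \sum_(s in K) mass v rho s) ^+ 2.
  by move=> [_ [_ [hf _ _]] _ <- _]; rewrite (energyE rho hn hf) sum_sqr_div.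
have term_ge0 f s : s \in K -> 0 <= mass v rho s *
    (image_volume v f s / mass v rho s - C / \sum_(s in K) mass v rho s) ^+ 2.
  by move=> Ks; rewrite mulr_ge0 ?sqr_ge0 // ltW ?mass_gt0.
have lb : lbound (energies v K rho C) (C ^+ 2 / \sum_(s in K) mass v rho s).
  by move=> _ [f hf <-]; rewrite -subr_ge0 energyB // sumr_ge0 // => s; apply: term_ge0.
split=> // f hf.
(* A term vanishes when image volume over mass equals the ratio of the totals; cross-multiplying by
   positive quantities turns this into mass preservation at [s]. *)
have term_eq0 s : s \in K ->
    (mass v rho s *
      (image_volume v f s / mass v rho s - C / \sum_(s in K) mass v rho s) ^+ 2 == 0) =
    (image_volume v f s / (\sum_(t in K) image_volume v f t) ==
      mass v rho s / (\sum_(t in K) mass v rho t)).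
  move=> Ks; have ms := mass_gt0 s Ks.
  case: (hf) => _ [_ [hK _ _]] _ sumC _; rewrite sumC.
  have iv0 t : t \in K -> 0 < image_volume v f t.
    by move=> /hK[ct ft]; apply: (volume_gt0 ct ft).
  have C0 : 0 < C.
    rewrite -sumC (bigD1 s) //= ltr_pwDl ?iv0 // sumr_ge0 // => t /andP[Kt _].
    by rewrite ltW ?iv0.
  rewrite mulf_eq0 gt_eqF //= sqrf_eq0 subr_eq0.
  have M0 : 0 < \sum_(t in K) mass v rho t.
    rewrite (bigD1 s) //= ltr_pwDl ?mass_gt0 // sumr_ge0 // => t /andP[Kt _].
    by rewrite ltW ?mass_gt0.
  by rewrite !eqr_div ?(gt_eqF ms) ?(gt_eqF C0) ?(gt_eqF M0) // [C * _]mulrC.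
split=> [[_ e] s Ks | mp].
  apply/eqP; rewrite -term_eq0 //; apply/eqP.
  have := energyB f hf; rewrite e subrr => /esym h.
  by apply: (psumr_eq0P (P := mem K) _ h) => // t Kt; apply: term_ge0.
have e : energy v K rho f = C ^+ 2 / \sum_(s in K) mass v rho s.
  apply/eqP; rewrite -subr_eq0 energyB // big1 // => s Ks.
  by apply/eqP; rewrite term_eq0 //; apply/eqP/mp.
by split=> //; split; [exists f | rewrite e].
Qed.
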